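(* $\mathrm{sat}^*(n,\mathcal D_2)=\Theta(n)$.
   Context: $\mathcal D_2$ is the diamond poset: 4 elements, one minimal, one maximal, two incomparable middle elements. A family $\mathcal F\subseteq\mathcal P([n])$ (ordered by inclusion) contains an induced copy of a poset $\mathcal P$ if there is an injection $f:\mathcal P\to\mathcal F$ that is an isomorphism of $\mathcal P$ onto $f(\mathcal P)$ with the inclusion order. $\mathcal F$ is $\mathcal P$-saturated if it contains no induced copy of $\mathcal P$ but for every $S\in\mathcal P([n])\setminus\mathcal F$ the family $\mathcal F\cup\{S\}$ does. $\mathrm{sat}^*(n,\mathcal P)$ is the minimum size of a $\mathcal P$-saturated family in $\mathcal P([n])$. *)

(* Defs.v *)
From HB Require Import structures.
From mathcomp Require Import all_boot all_order all_algebra.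
From mathcomp Require Import all_classical all_reals all_analysis.

Set Implicit Arguments.
Unset Strict Implicit.
Unset Printing Implicit Defensive.

Import Order.Theory GRing.Theory Num.Theory.
Import numFieldNormedType.Exports.

Local Open Scope nat_scope.

(* The diamond: the product order on bool * bool, with false < true.
   diamondE below spells out the order relation. *)
Definition diamond : finPOrderType _ := (bool *p bool)%type.

Section Saturation.
Variables (d : Order.disp_t) (P : finPOrderType d) (n : nat).
Implicit Types F : {set {set 'I_n}}.

Definition has_induced_copy F : bool :=
  [exists f : {ffun P -> {set 'I_n}},
    [&& injectiveb f, [forall x, f x \in F] &
        [forall x, forall y, (f x \subset f y) == (x <= y)%O]]].

Definition saturated F : bool :=
  ~~ has_induced_copy F &&
  [forall S : {set 'I_n}, (S \notin F) ==> has_induced_copy (S |: F)].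

(* The idle value 2 ^ n is the size of the largest family, so it does not
   affect the minimum as soon as a saturated family exists, which is the case
   for every nonempty P (sat_starP). *)
Definition sat_star : nat :=
  \big[minn/2 ^ n]_(F : {set {set 'I_n}} | saturated F) #|F|.

Lemma has_induced_copyP F :
  reflect (exists f : P -> {set 'I_n},
             [/\ injective f, forall x, f x \in F &
                 forall x y, (f x \subset f y) = (x <= y)%O])
          (has_induced_copy F).
Proof.
apply: (iffP existsP) => [[f /and3P[/injectiveP fI /forallP fF /forallP fO]]|].
  by exists f; split=> // x y; apply/eqP; move/forallP: (fO x).
case=> f [fI fF fO]; exists [ffun x => f x]; apply/and3P; split.
- by apply/injectiveP => x y; rewrite !ffunE => /fI.
- by apply/forallP => x; rewrite ffunE.
- by apply/forallP => x; apply/forallP => y; rewrite !ffunE fO.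
Qed.

Lemma saturated_exists : 0 < #|P| -> exists F, saturated F.
Proof.
case/card_gt0P=> x0 _.
have free0 : ~~ has_induced_copy finset.set0.
  by apply/has_induced_copyP => -[f [_ /(_ x0)]]; rewrite inE.
case: (@arg_maxnP _ finset.set0 (fun F => ~~ has_induced_copy F)
         (fun F => #|F|) free0) => F freeF maxF.
exists F; rewrite /saturated freeF; apply/forallP => S; apply/implyP => SF.
apply: contraT => /maxF; rewrite cardsU1 SF add1n.
by rewrite /= leqNgt leqnn.
Qed.

Lemma sat_starP : 0 < #|P| ->
  (exists2 F, saturated F & #|F| = sat_star) /\
  (forall F, saturated F -> sat_star <= #|F|).
Proof.
move=> /saturated_exists[F0 satF0].
have lb F : saturated F -> sat_star <= #|F|.
  move=> satF; have := bigmin_le_cond (2 ^ n) (fun G : {set {set 'I_n}} => #|G|) satF.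
  by rewrite minEnat leEnat.
split=> //.
case: (@arg_minnP _ F0 saturated (fun F => #|F|) satF0) => F satF minF.
exists F => //; apply/eqP; rewrite eqn_leq lb // andbT /sat_star.
elim/big_ind: _ => [|a b Fa Fb|G /minF //].
  by rewrite (leq_trans (max_card _)) //= -cardsT -powersetT card_powerset
             cardsT card_ord.
by rewrite leq_min Fa.
Qed.

End Saturation.

Arguments has_induced_copy {d} P {n} F.
Arguments saturated {d} P {n} F.
Arguments sat_star {d} P n.

Lemma card_diamond : #|diamond| = 4.
Proof. by rewrite card_prod card_bool. Qed.

Lemma diamondE (x y : diamond) :
  (x <= y)%O = [|| x == y, x == (false, false) | y == (true, true)].
Proof. by case: x y => [[] []] [[] []]. Qed.

(* Main.v *)
(* The lower bound n <= |F| + 1 is a rank argument. Otherwise some nonzero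
   vector x in Q^n sums to zero on [n] and on every member of the saturated
   family F. Saturation shows that any set meeting every member of F contains a
   union of two complements of members of F which still meets every member;
   since x sums to zero on these complements, this forces x i = 0 whenever i
   lies in a minimal member of F, and dually whenever i lies outside a maximal
   member. For every other i, a maximal A in F avoiding i has i |: A in F as
   well, so x i = 0 again. The upper bound n + 1 is attained by the empty set
   together with the singletons. *)
Require Import Defs.
From mathcomp Require Import all_boot all_order all_algebra.

Set Implicit Arguments.
Unset Strict Implicit.
Unset Printing Implicit Defensive.

Import Order.TTheory GRing.Theory Num.Theory.

(** * Diamonds in set families, and duality under complementation *)

Section DiamondSaturation.
Variable T : finType.
Implicit Types (F : {set {set T}}) (A B C D S Y : {set T}).

(** Incomparability of [A] and [B] makes the four sets distinct, so this describes an induced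
    copy. *)
Definition is_diamond D A B C : bool :=
  [&& D \subset A, D \subset B, A \subset C, B \subset C,
      ~~ (A \subset B) & ~~ (B \subset A)].

Definition has_diamond F : Prop := exists D A B C,
  [/\ D \in F, A \in F, B \in F & C \in F] /\ is_diamond D A B C.

Definition diamond_saturated F : Prop :=
  ~ has_diamond F /\ forall S, S \notin F -> has_diamond (S |: F).

Lemma is_diamondC D A B C : is_diamond D A B C = is_diamond D B A C.
Proof. by apply/and5P/and5P=> -[-> -> -> -> /andP[-> ->]]. Qed.

Lemma is_diamond_setC D A B C :
  is_diamond (~: C) (~: A) (~: B) (~: D) = is_diamond D A B C.
Proof.
by rewrite /is_diamond !setCS; apply/and5P/and5P=> -[-> -> -> -> /andP[-> ->]].
Qed.

Lemma has_diamond_setC F : has_diamond (@setC T @: F) -> has_diamond F.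
Proof.
case=> _ [_ [_ [_ [[/imsetP[D DF ->] /imsetP[A AF ->] /imsetP[B BF ->]
  /imsetP[C CF ->]]]]]]; rewrite is_diamond_setC => dia.
by exists C, A, B, D.
Qed.

Lemma setC_imsetK F : @setC T @: (@setC T @: F) = F.
Proof.
by rewrite -imset_comp -[RHS]imset_id; apply: eq_imset => A /=; rewrite setCK.
Qed.

Lemma diamond_saturated_setC F :
  diamond_saturated F -> diamond_saturated (@setC T @: F).
Proof.
case=> free sat; split=> [/has_diamond_setC // | S SF].
apply: has_diamond_setC; rewrite imsetU1 setC_imsetK; apply: sat.
by apply: contra SF => SF; apply/imsetP; exists (~: S); rewrite ?setCK.
Qed.

(** The four sets of a diamond are distinct, so [S] fills exactly one place; the two middle places
    are interchangeable. *)
Lemma has_diamondU1 F S : ~ has_diamond F -> has_diamond (S |: F) ->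
  [\/ exists A B C, [/\ A \in F, B \in F & C \in F] /\ is_diamond S A B C,
      exists D A B, [/\ D \in F, A \in F & B \in F] /\ is_diamond D A B S
    | exists D B C, [/\ D \in F, B \in F & C \in F] /\ is_diamond D S B C].
Proof.
move=> free [D [A [B [C [[]]]]]]; rewrite !in_setU1 => DF AF BF CF dia.
have [sDA sDB sAC sBC /andP[AB BA]] := and5P dia.
case: (eqVneq A S) AF => [AS _|_ /= AF].
  have {}BF : B \in F by case: eqP BF AB => // ->; rewrite AS subxx.
  have {}DF : D \in F by case: eqP DF sDB AB => // -> _; rewrite AS => ->.
  have {}CF : C \in F by case: eqP CF sBC BA => // -> _; rewrite AS => ->.
  by constructor 3; exists D, B, C; rewrite -AS.
case: (eqVneq B S) BF => [BS _|_ /= BF].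
  have {}DF : D \in F by case: eqP DF sDA BA => // -> _; rewrite BS => ->.
  have {}CF : C \in F by case: eqP CF sAC AB => // -> _; rewrite BS => ->.
  by constructor 3; exists D, A, C; rewrite -BS is_diamondC.
case: (eqVneq D S) DF => [DS _|_ /= DF].
  have {}CF : C \in F.
    case: eqP CF sBC BA sDA => // -> _ sBC BA sDA.
    by rewrite (subset_trans sBC) // -DS in BA.
  by constructor 1; exists A, B, C; rewrite -DS.
case: (eqVneq C S) CF => [CS _|_ /= CF].
  by constructor 2; exists D, A, B; rewrite -CS.
by case: free; exists D, A, B, C.
Qed.

(** * Transversals and one-point extensions in saturated families *)

Definition transversal_of F Y : bool :=
  [forall A in F, ~~ [disjoint A & Y]].

Lemma transversal_of_setC F Y :
  transversal_of F (~: Y) = [forall A in F, ~~ (A \subset Y)].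
Proof. by apply: eq_forallb => A; rewrite disjoints_subset setCK. Qed.

(* The complement of Y lies above no member of F, so it can only be the bottom
   of a diamond; diamond-freeness then keeps F out of the subsets of A :&: B. *)
Lemma transversal_saturated F Y : diamond_saturated F -> transversal_of F Y ->
  exists A B, [/\ A \in F, B \in F, ~: A :|: ~: B \subset Y &
                  transversal_of F (~: A :|: ~: B)].
Proof.
move=> [free sat] trY.
have noF A : A \in F -> ~~ (A \subset ~: Y).
  by move=> AF; rewrite -disjoints_subset (forall_inP trY).
have YF : ~: Y \notin F by apply/negP=> /noF; rewrite subxx.
case: (has_diamondU1 free (sat _ YF)) => -[A [B [C [[AF BF CF] dia]]]].
- have [sYA sYB sAC sBC /andP[AB BA]] := and5P dia.
  exists A, B; split=> //; rewrite -setCI.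
    by rewrite subCset; apply/subsetIP; split.
  rewrite transversal_of_setC; apply/forall_inP=> D DF.
  apply/negP=> /subsetIP[sDA sDB]; case: free; exists D, A, B, C; split=> //.
  by rewrite /is_diamond sDA sDB sAC sBC AB BA.
- have [sAB _ sBY _ _] := and5P dia.
  by have := noF _ BF; rewrite sBY.
- have [sAY _ _ _ _] := and5P dia.
  by have := noF _ AF; rewrite sAY.
Qed.

(** Take [A] maximal among the members avoiding [i]. If [i |: A] were missing, the diamond it
    creates could be rebuilt inside [F]. *)
Lemma saturated_add_point F i : diamond_saturated F -> F != set0 ->
  (forall H, minset (mem F) H -> i \notin H) ->
  (forall K, maxset (mem F) K -> i \in K) ->
  exists A, [/\ A \in F, i |: A \in F & i \notin A].
Proof.
move=> [free sat] /set0Pn[A0 A0F] Hmin Kmax.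
have [H0 H0min _] := minset_exists (P := mem F) A0F.
pose P := [pred A : {set T} | (A \in F) && (i \notin A)].
have PH0 : P H0 by apply/andP; split; [apply: (minsetp H0min) | apply: Hmin].
have [A /maxsetP[/andP[AF iA] Amax] _] := maxset_exists PH0.
exists A; split=> //; apply: contraT => SF.
have sAS : A \subset i |: A by apply: subsetUr.
have iS B : i \in B -> A \subset B -> i |: A \subset B.
  by move=> iB sAB; rewrite subUset sub1set iB.
case: (has_diamondU1 free (sat _ SF)).
- case=> B1 [B2 [C [[B1F B2F CF] /and5P[s1 s2 s3 s4 /andP[n1 n2]]]]].
  case: free; exists A, B1, B2, C; split=> //.
  by rewrite /is_diamond (subset_trans sAS s1) (subset_trans sAS s2) s3 s4 n1 n2.
- case=> D [B1 [B2 [[DF B1F B2F] /and5P[s1 s2 s3 s4 /andP[n1 n2]]]]].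
  (* A maximal member above [A] contains [i], hence [i |: A], and replaces it as the top. *)
  have [K Km sAK] := maxset_exists (P := mem F) AF.
  have sSK := iS _ (Kmax _ Km) sAK.
  case: free; exists D, B1, B2, K; split; first by split=> //; apply: (maxsetp Km).
  by rewrite /is_diamond s1 s2 (subset_trans s3 sSK) (subset_trans s4 sSK) n1 n2.
- case=> D [B [C [[DF BF CF] /and5P[sDS sDB sSC sBC /andP[nSB nBS]]]]].
  have sAC := subset_trans sAS sSC.
  have [iD|iD] := boolP (i \in D).
    (* A minimal member below [D] avoids [i], so it lies in [A]; now [A] and [D] become the middle
       sets. *)
    have [H Hm sHD] := minset_exists (P := mem F) DF.
    have iH := Hmin _ Hm.
    have sHA : H \subset A.
      apply/subsetP=> x xH; have := subsetP sDS _ (subsetP sHD _ xH).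
      by rewrite in_setU1 => /predU1P[xi|//]; rewrite -xi xH in iH.
    have sDC := subset_trans sDS sSC.
    case: free; exists H, A, D, C; split; first by split=> //; apply: (minsetp Hm).
    rewrite /is_diamond sHA sHD sAC sDC /=; apply/andP; split.
      by apply: contra nSB => sAD; rewrite (subset_trans (iS _ iD sAD)).
    by apply: contra iA => /subsetP/(_ _ iD).
  (* Here [A] itself replaces [i |: A] in the middle; maximality of [A] keeps it from lying below
     [B]. *)
  have sDA : D \subset A.
    apply/subsetP=> x xD; have := subsetP sDS _ xD.
    by rewrite in_setU1 => /predU1P[xi|//]; rewrite -xi xD in iD.
  case: free; exists D, A, B, C; split=> //.
  rewrite /is_diamond sDA sDB sAC sBC /=; apply/andP; split.
    apply/negP=> sAB; have [iB|iB] := boolP (i \in B).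
      by rewrite iS in nSB.
    have BA : B = A by apply: Amax => //=; rewrite BF iB.
    by rewrite BA sAS in nBS.
  by apply: contra nBS => sBA; apply: subset_trans sAS.
Qed.

(** * Vanishing of vectors that sum to zero on every member *)

Section Kernel.
Local Open Scope ring_scope.
Variables (R : realDomainType) (x : T -> R).

(* A linear-algebra argument in the style of Seymour's bound for critically
   non-2-colourable hypergraphs: the positive part of x, completed inside the
   zero set Z by a minimal transversal P through i, is again a transversal. *)
Lemma sum0_minset F i H : diamond_saturated F ->
  (forall A, A \in F -> \sum_(j in A) x j = 0) -> \sum_j x j = 0 ->
  minset (mem F) H -> i \in H -> x i = 0.
Proof.
move=> satF x0 xT /minsetP[/= HF Hmin] iH.
apply/eqP; apply: contraT => xi.
have trH : transversal_of F (~: (H :\ i)).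
  rewrite transversal_of_setC; apply/forall_inP=> A AF; apply/negP=> sAH.
  have AH : A = H by apply: Hmin => //; apply: subset_trans sAH (subD1set _ _).
  by have := subsetP sAH i; rewrite AH !inE eqxx iH => /(_ isT).
have [P /minsetP[trP Pmin] sPH] := minset_exists trH.
(* [P] must meet [H], and [i] is the only point of [H] allowed in it. *)
have iP : i \in P.
  have /forall_inP/(_ H HF) := trP; apply: contraNT => iP.
  rewrite -setI_eq0; apply/eqP/setP=> j; rewrite !inE; apply/negP=> /andP[jH jP].
  have := subsetP sPH _ jP; rewrite !inE jH andbT negbK => /eqP ji.
  by rewrite -ji jP in iP.
pose Z := [set j | x j == 0]; pose Y := (P :&: Z) :|: [set j | 0 < x j].
(* A member without positive entries sums to zero, so it lies inside [Z], where [P] meets it. *)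
have trY : transversal_of F Y.
  apply/forall_inP=> A AF; apply/negP; rewrite -setI_eq0 => /eqP AY.
  have xle j : j \in A -> x j <= 0.
    move=> jA; rewrite leNgt; apply/negP=> xj.
    by have /setP/(_ j) := AY; rewrite !inE jA xj orbT.
  have xA0 j : j \in A -> x j = 0.
    move=> jA; apply/eqP; rewrite -oppr_eq0.
    have /psumr_eq0P : \sum_(k in A) - x k = 0 by rewrite sumrN x0 // oppr0.
    by move=> -> //= k kA; rewrite oppr_ge0 xle.
  have /forall_inP/(_ A AF) := trP; rewrite -setI_eq0 => /set0Pn[j].
  rewrite inE => /andP[jA jP].
  by have /setP/(_ j) := AY; rewrite !inE jA jP xA0 ?eqxx.
have [A [B [AF BF]]] := transversal_saturated satF trY.
rewrite subUset => /andP[sA sB] trAB.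
have inPZ C : C \in F -> ~: C \subset Y -> ~: C \subset P :&: Z.
  move=> CF sC.
  have x0C : \sum_(j in ~: C) x j = 0.
    move: xT; rewrite (bigID [in C]) /= x0 // add0r => xT.
    by rewrite -[RHS]xT; apply: eq_bigl => j; rewrite inE.
  have xge j : j \in ~: C -> 0 <= x j.
    by move/(subsetP sC); rewrite !inE => /orP[/andP[_ /eqP->]|/ltW].
  have /psumr_eq0P xC0 := x0C.
  apply/subsetP=> j jC; have := subsetP sC _ jC.
  by rewrite !inE (xC0 xge) // eqxx ltxx orbF.
have sPZ : ~: A :|: ~: B \subset P :&: Z by rewrite subUset !inPZ.
(* Minimality makes this union all of [P], so [P], and with it [i], lies in [Z]. *)
have := Pmin _ trAB (subset_trans sPZ (subsetIl _ _)).
by move=> PE; have := subsetP sPZ i; rewrite PE !inE iP (negPf xi) => /(_ isT).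
Qed.

Lemma sum0_saturated F i : diamond_saturated F -> F != set0 ->
  (forall A, A \in F -> \sum_(j in A) x j = 0) -> \sum_j x j = 0 -> x i = 0.
Proof.
move=> satF F0 x0 xT; apply/eqP; apply: contraT => xi.
have [||A [AF SF iA]] := saturated_add_point (i := i) satF F0.
- by move=> H Hm; apply: contra xi => iH; rewrite (sum0_minset satF x0 xT Hm).
- move=> K Km; apply: contraR xi => iK; apply/eqP.
  (* In the family of complements, [~: K] is a minimal member containing [i]. *)
  apply: (sum0_minset (H := ~: K) (diamond_saturated_setC satF)) => //.
  + move=> _ /imsetP[A AF ->]; move: xT; rewrite (bigID [in A]) /= x0 // add0r.
    by move=> xT; rewrite -[RHS]xT; apply: eq_bigl => j; rewrite inE.
  + have /maxsetP[KF Kmax] := Km.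
    apply/minsetP; split=> /= [|_ /imsetP[B BF ->]]; first exact: imset_f.
    by rewrite setCS => /(Kmax _ BF) ->.
  + by rewrite inE.
- have := x0 _ SF; rewrite big_setU1 //= x0 // addr0 => xi0.
  by rewrite xi0 eqxx in xi.
Qed.

End Kernel.

(** * Rank argument and lower bound *)

Lemma ex_sum0 (R : fieldType) F : #|F|.+1 < #|T| ->
  exists x : T -> R, [/\ exists i, x i != 0%R,
    forall A, A \in F -> (\sum_(j in A) x j = 0)%R & (\sum_j x j = 0)%R].
Proof.
move=> ltFT.
(* The default value [setT] is reached at index [#|F|], so the last column of [M] encodes the total
   sum. *)
pose S k := nth setT (enum F) k.
pose M : 'M[R]_(#|T|, #|F|.+1) := (\matrix_(i, k) (enum_val i \in S k)%:R)%R.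
have : (kermx M != 0)%R.
  rewrite kermx_eq0 /row_free neq_ltn (leq_ltn_trans _ ltFT) //.
  exact: rank_leq_col.
case/rowV0Pn=> v /sub_kermxP vM v0.
pose x t := v ord0 (enum_rank t).
have xS k : k < #|F|.+1 -> (\sum_(j in S k) x j = 0)%R.
  move=> kF; have /rowP/(_ (Ordinal kF)) := vM; rewrite !mxE => vMk.
  rewrite -[RHS]vMk big_mkcond (reindex_onto (@enum_val _ T) enum_rank) /=; last first.
    by move=> t _; rewrite enum_rankK.
  apply: eq_big => [i|i _]; first by rewrite enum_valK eqxx.
  by rewrite !mxE /x enum_valK; case: (_ \in S k); rewrite (mulr0, mulr1).
exists x; split.
- case/rV0Pn: v0 => i vi.
  by exists (enum_val i); rewrite /x enum_valK.
- move=> A AF; have AE : A \in enum F by rewrite mem_enum.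
  rewrite -(nth_index setT AE); apply: xS.
  by rewrite ltnS cardE ltnW // index_mem.
- rewrite -[RHS](xS #|F|) //; apply: eq_bigl => j.
  by rewrite /S nth_default ?inE // cardE.
Qed.

Lemma card_diamond_saturated F : diamond_saturated F -> #|T| <= #|F|.+1.
Proof.
move=> satF; rewrite leqNgt; apply/negP=> /(ex_sum0 rat)[x [[i xi] x0 xT]].
case/negP: xi; apply/eqP; apply: (sum0_saturated i satF) => //.
(* An empty [F] is not saturated: adding [set0] gives a single set, hence no diamond. *)
apply/eqP=> F0; have /satF.2 : set0 \notin F by rewrite F0 inE.
rewrite F0 setU0 => -[D [A [B [C [[_ /set1P-> /set1P-> _]]]]]].
by case/and5P=> _ _ _ _; rewrite subxx.
Qed.

(** * Upper bound by the empty set and the singletons *)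

Definition points : {set {set T}} := set0 |: [set [set i] | i in T].

Lemma card_points : #|points| = #|T|.+1.
Proof.
rewrite cardsU1 card_imset ?cardsT; last exact: set1_inj.
by case: imsetP => // -[i _ /setP/(_ i)]; rewrite !inE eqxx.
Qed.

(** The top of a diamond has at least two elements, which no member has. A missing set has two
    points, whose singletons form the middle of a diamond below it. *)
Lemma points_saturated : diamond_saturated points.
Proof.
have inP A : A \in points -> #|A| <= 1.
  by rewrite in_setU1 => /predU1P[->|/imsetP[i _ ->]]; rewrite ?cards0 ?cards1.
have inP1 i : [set i] \in points by rewrite in_setU1 imset_f ?orbT.
split=> [[D [A [B [C [[DF AF BF CF] /and5P[_ _ sAC sBC /andP[AB BA]]]]]]]|S SF].
  have C1 := inP _ CF.
  have AE : A = C.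
    apply/eqP; rewrite eqEcard sAC (leq_trans C1) // card_gt0.
    by apply: contraNneq AB => ->; apply: sub0set.
  by rewrite AE sBC in BA.
have [i iS] : exists i, i \in S.
  apply/set0Pn; apply: contraNneq SF => ->; exact: setU11.
have [j jS ji] : exists2 j, j \in S & j != i.
  have : ~~ (S \subset [set i]).
    rewrite subset1; apply: contra SF => /orP[/eqP-> //|/eqP->].
    exact: setU11.
  by case/subsetPn=> j jS; rewrite inE => ji; exists j.
exists set0, [set i], [set j], S; split.
  by split; rewrite in_setU1 ?eqxx ?inP1 ?orbT // in_setU1 eqxx ?orbT.
rewrite /is_diamond !sub0set !sub1set iS jS !inE ji.
by rewrite eq_sym ji.
Qed.

End DiamondSaturation.

(** * Transfer to induced copies and the asymptotic statement *)

Lemma has_induced_copy_diamond n (F : {set {set 'I_n}}) :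
  reflect (has_diamond F) (has_induced_copy diamond F).
Proof.
apply: (iffP (has_induced_copyP _ _)) => [[f [fI fF fO]]|].
  exists (f (false, false)), (f (true, false)), (f (false, true)), (f (true, true)).
  by split; [split | rewrite /is_diamond !fO !diamondE].
case=> D [A [B [C [[DF AF BF CF] /and5P[DA DB AC BC /andP[AB BA]]]]]].
pose f (p : diamond) := match p with
  | (false, false) => D | (true, false) => A
  | (false, true) => B | (true, true) => C end.
have DC := subset_trans DA AC.
have AD : (A \subset D) = false.
  by apply: contraNF AB => AD; apply: subset_trans DB.
have BD : (B \subset D) = false.
  by apply: contraNF BA => BD; apply: subset_trans DA.
have CA : (C \subset A) = false by apply: contraNF BA; apply: subset_trans.
have CB : (C \subset B) = false by apply: contraNF AB; apply: subset_trans.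
have CD : (C \subset D) = false by apply: contraFF CA => CD; apply: subset_trans DA.
have fO p q : (f p \subset f q) = (p <= q)%O.
  by rewrite diamondE; case: p q => [[] []] [[] []] /=;
    rewrite ?subxx ?(negPf AB) ?(negPf BA).
exists f; split=> // [p q fpq|[[] []] //].
by apply/le_anti; rewrite -!fO fpq subxx.
Qed.

Lemma saturated_diamond n (F : {set {set 'I_n}}) :
  saturated diamond F <-> diamond_saturated F.
Proof.
rewrite /saturated; split.
  case/andP=> /has_induced_copy_diamond free /forallP sat; split=> // S SF.
  by apply/has_induced_copy_diamond; apply: implyP (sat S) SF.
case=> free sat; apply/andP; split; first exact/has_induced_copy_diamond.
by apply/forallP=> S; apply/implyP=> /sat/has_induced_copy_diamond.
Qed.

Lemma sat_star_diamond_bounds n :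
  n <= (sat_star diamond n).+1 /\ sat_star diamond n <= n.+1.
Proof.
have [|[F /saturated_diamond satF <-] lb] := @sat_starP _ diamond n.
  by rewrite card_diamond.
split; first by have := card_diamond_saturated satF; rewrite card_ord.
have := @card_points 'I_n; rewrite card_ord => <-; apply: lb.
exact/saturated_diamond/points_saturated.
Qed.

From mathcomp Require Import all_classical all_reals all_analysis zify.
Import numFieldNormedType.Exports.

Local Open Scope classical_set_scope.
Local Open Scope ring_scope.

Theorem theorem2 (R : realType) :
  (fun n : nat => (sat_star diamond n)%:R : R^o) =Theta_\oo
  (fun n : nat => n%:R : R^o).
Proof.
rewrite eqThetaE; apply/asboolP.
(* The bounds n - 1 and n + 1 lie between n / 2 and 2 n once n is at least 2. *)
exists (2^-1, 2) => /=; first by rewrite invr_gt0 !ltr0n.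
near=> n.
have [lo up] := sat_star_diamond_bounds n.
have n2 : (2 <= n)%N by near: n; exists 2%N.
rewrite !normr_nat mulrC ler_pdivrMr ?ltr0n // -!natrM !ler_nat.
by split; lia.
Unshelve. all: by end_near.
Qed.
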